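(* Let $V<C<M$ be real numbers, let $0\le p_1\le p_2\le p_3\le p_4\le 1$, $\tilde p=(p_1,p_2,p_3,p_4)$, and let $\beta\in[0,1]$. Let $X_{\tilde p,\beta}$ be a real random variable with cumulative distribution function $F_{\tilde p,\beta}(x)=\frac12H(x)+(1-\beta)(J(x)-H(x))$. Then $X_{\tilde p,\beta}$ has probability density function $$f_{X_{\tilde p,\beta}}(x)=(2\beta-1)\Big(f_1(x)\big(P_1F_1(x)+P_2F_2(x)\big)+f_2(x)\big(P_2F_1(x)+P_3F_2(x)\big)\Big)+(1-\beta)\Big((P_1+P_2)f_1(x)+(P_2+P_3)f_2(x)\Big),$$ and the order quantity $Q\in\mathbb{R}$ that maximizes the defuzzified expected fuzzy profit $$(1-\beta)\int_0^1\mathbb{E}[Y^1_\alpha]\,d\alpha+\beta\int_0^1\mathbb{E}[Y^2_\alpha]\,d\alpha$$ is the solution of the classical newsvendor problem with demand $X_{\tilde p,\beta}$, i.e. it is the unique maximizer over $Q\in\mathbb{R}$ of $\mathbb{E}[\pi(X_{\tilde p,\beta})]$. (All objects are defined in the context.)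
   Context: $C$ is the unit purchase cost, $M$ the unit selling price, $V$ the unit salvage value, $Q$ the order quantity. Put $A=M-V>0$, $a=V-C<0$, $b=M-C>0$. The newsvendor profit for demand $x$ is $\pi(x)=Ax+aQ$ if $x\le Q$ and $\pi(x)=bQ$ if $x>Q$; for a demand $X$ with density $f_X$, $\mathbb{E}[\pi(X)]=\int_{-\infty}^Q(Ax+aQ)f_X(x)\,dx+\int_Q^\infty bQ\,f_X(x)\,dx$. For $i=1,2$, $f_i$ is the density of the normal distribution with mean $\mu_i\in\mathbb{R}$ and standard deviation $\sigma_i>0$, and $F_i$ is its cumulative distribution function. The trapezoidal fuzzy number $\tilde p=(p_1,p_2,p_3,p_4)$ has $\alpha$-cuts $[p^1_\alpha,p^2_\alpha]$ with $p^1_\alpha=p_1+(p_2-p_1)\alpha$ and $p^2_\alpha=p_4+(p_3-p_4)\alpha$, $0\le\alpha\le1$. For each $\alpha\in[0,1]$, $X^1_\alpha$ and $X^2_\alpha$ are independent real random variables with densities $p^1_\alpha f_1+(1-p^1_\alpha)f_2$ and $p^2_\alpha f_1+(1-p^2_\alpha)f_2$ respectively. Put $X^{(1)}_\alpha=\min(X^1_\alpha,X^2_\alpha)$ and $X^{(2)}_\alpha=\max(X^1_\alpha,X^2_\alpha)$. The fuzzy profit has $\alpha$-cuts $[Y^1_\alpha,Y^2_\alpha]$, where $Y^1_\alpha=\min_{x\in[X^{(1)}_\alpha,X^{(2)}_\alpha]}\pi(x)$ and $Y^2_\alpha=\max_{x\in[X^{(1)}_\alpha,X^{(2)}_\alpha]}\pi(x)$.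 Constants: $P_1=\frac{p_1p_3}{3}+\frac{2p_2p_3}{3}+\frac{2p_1p_4}{3}+\frac{p_2p_4}{3}$, $P_2=\frac{p_1+p_2+p_3+p_4}{2}-\frac{p_1p_3}{3}-\frac{2p_1p_4}{3}-\frac{2p_2p_3}{3}-\frac{p_2p_4}{3}$, $P_3=2-(p_1+p_2+p_3+p_4)+\frac{p_1p_3}{3}+\frac{2p_1p_4}{3}+\frac{2p_2p_3}{3}+\frac{p_2p_4}{3}$. Functions: $H(x)=P_1F_1(x)^2+2P_2F_1(x)F_2(x)+P_3F_2(x)^2$, $J(x)=P_1F_1(x)+P_2(F_1(x)+F_2(x))+P_3F_2(x)$. For every $\beta\in[0,1]$ the function $F_{\tilde p,\beta}$ is a cumulative distribution function. *)

(* Defs.v *)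
From HB Require Import structures.
From mathcomp Require Import all_boot all_order all_algebra.
From mathcomp Require Import all_classical all_reals all_analysis.

Set Implicit Arguments.
Unset Strict Implicit.
Unset Printing Implicit Defensive.

Import Order.TTheory GRing.Theory Num.Theory.
Import numFieldNormedType.Exports.

Local Open Scope classical_set_scope.
Local Open Scope ring_scope.

Definition has_density (R : realType) (d : measure_display)
    (T : measurableType d) (P : probability T R) (X : {RV P >-> R})
    (f : R -> R) : Prop :=
  [/\ measurable_fun [set: R] f,
      forall x, 0 <= f x &
      forall A : set R, measurable A ->
        distribution P X A = (\int[lebesgue_measure]_(x in A) (f x)%:E)%E].

Definition independent_RV (R : realType) (d : measure_display)
    (T : measurableType d) (P : probability T R) (X Y : {RV P >-> R}) : Prop :=
  forall A B : set R, measurable A -> measurable B ->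
    P ((X @^-1` A) `&` (Y @^-1` B)) = (P (X @^-1` A) * P (Y @^-1` B))%E.

Definition maximizes (R : realType) (obj : R -> \bar R) (Q : R) : Prop :=
  forall Q' : R, (obj Q' <= obj Q)%E.

Definition normal_cdf (R : realType) (mu sigma x : R) : R :=
  fine (normal_prob mu sigma `]-oo, x]).

Definition mixture_pdf (R : realType) (p : R) (f1 f2 : R -> R) (x : R) : R :=
  p * f1 x + (1 - p) * f2 x.

(* C, M and V are the unit purchase cost, selling price and salvage value. *)
Definition profit (R : realType) (C M V Q x : R) : R :=
  if x <= Q then (M - V) * x + (V - C) * Q else (M - C) * Q.

Definition newsvendor_objective (R : realType) (d : measure_display)
    (T : measurableType d) (P : probability T R) (C M V : R)
    (X : {RV P >-> R}) (Q : R) : \bar R :=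
  'E_P[fun w => profit C M V Q (X w)].

(* End points of the alpha-cut of the trapezoidal number (p1, p2, p3, p4). *)
Definition cut_left (R : realType) (p1 p2 alpha : R) : R :=
  p1 + (p2 - p1) * alpha.

Definition cut_right (R : realType) (p3 p4 alpha : R) : R :=
  p4 + (p3 - p4) * alpha.

(* Profits attained on the realized demand interval [min(x, y), max(x, y)].
   [profit C M V Q] is continuous and the interval is compact and nonempty, so
   the [inf] and [sup] below are attained, i.e., are a minimum and a maximum. *)
Definition profit_range (R : realType) (C M V Q x y : R) : set R :=
  profit C M V Q @` `[Num.min x y, Num.max x y].

Definition profit_lower (R : realType) (C M V Q x y : R) : R :=
  inf (profit_range C M V Q x y).

Definition profit_upper (R : realType) (C M V Q x y : R) : R :=
  sup (profit_range C M V Q x y).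

(* X1 and X2 are the alpha-indexed families of demands; only alpha in [0, 1]
   matters. *)
Definition defuzzified_profit (R : realType) (d : measure_display)
    (T : measurableType d) (P : probability T R) (C M V beta : R)
    (X1 X2 : R -> {RV P >-> R}) (Q : R) : \bar R :=
  ((1 - beta)%:E *
     \int[lebesgue_measure]_(alpha in `[0%R, 1%R])
       'E_P[fun w => profit_lower C M V Q (X1 alpha w) (X2 alpha w)] +
   beta%:E *
     \int[lebesgue_measure]_(alpha in `[0%R, 1%R])
       'E_P[fun w => profit_upper C M V Q (X1 alpha w) (X2 alpha w)])%E.

Definition coefP1 (R : realType) (p1 p2 p3 p4 : R) : R :=
  p1 * p3 / 3 + 2 * p2 * p3 / 3 + 2 * p1 * p4 / 3 + p2 * p4 / 3.

Definition coefP2 (R : realType) (p1 p2 p3 p4 : R) : R :=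
  (p1 + p2 + p3 + p4) / 2 - p1 * p3 / 3 - 2 * p1 * p4 / 3
  - 2 * p2 * p3 / 3 - p2 * p4 / 3.

Definition coefP3 (R : realType) (p1 p2 p3 p4 : R) : R :=
  2 - (p1 + p2 + p3 + p4) + p1 * p3 / 3 + 2 * p1 * p4 / 3
  + 2 * p2 * p3 / 3 + p2 * p4 / 3.

Definition funH (R : realType) (P1 P2 P3 : R) (F1 F2 : R -> R) (x : R) : R :=
  P1 * F1 x ^+ 2 + 2 * P2 * F1 x * F2 x + P3 * F2 x ^+ 2.

Definition funJ (R : realType) (P1 P2 P3 : R) (F1 F2 : R -> R) (x : R) : R :=
  P1 * F1 x + P2 * (F1 x + F2 x) + P3 * F2 x.

Definition demand_cdf (R : realType) (P1 P2 P3 beta : R) (F1 F2 : R -> R)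
    (x : R) : R :=
  1 / 2 * funH P1 P2 P3 F1 F2 x
  + (1 - beta) * (funJ P1 P2 P3 F1 F2 x - funH P1 P2 P3 F1 F2 x).

Definition demand_pdf (R : realType) (P1 P2 P3 beta : R) (f1 f2 F1 F2 : R -> R)
    (x : R) : R :=
  (2 * beta - 1) * (f1 x * (P1 * F1 x + P2 * F2 x)
                    + f2 x * (P2 * F1 x + P3 * F2 x))
  + (1 - beta) * ((P1 + P2) * f1 x + (P2 + P3) * f2 x).

(* Main.v *)
(** Since [profit Q x = (M - C) Q - (M - V) max (Q - x) 0] is nondecreasing in
    [x], the bounds of its range are the profits at the minimum and at the
    maximum of the two demands.  Tonelli turns the expected shortfall into the
    integral of the demand cdf over [(-oo, Q]], so the expected profit is a
    functional of the cdf that is affine in it.  The cdfs [G1 + G2 - G1 G2] of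
    the minimum and [G1 G2] of the maximum are quadratic in the normal cdfs
    [F1], [F2], with coefficients polynomial in [alpha]; averaging them over
    [alpha] with weights [1 - beta] and [beta] gives exactly the demand cdf.
    The two objectives are therefore the same function of [Q].  The demand cdf
    is continuous and strictly increasing, so this function has its unique
    maximum at the critical fractile [F Q = (M - C) / (M - V)]. *)

Require Import Defs.
From HB Require Import structures.
From mathcomp Require Import all_boot all_order all_algebra.
From mathcomp Require Import all_classical all_reals all_analysis.
From mathcomp Require Import measurable_realfun ring lra.

Set Implicit Arguments.
Unset Strict Implicit.
Unset Printing Implicit Defensive.

Import Order.TTheory GRing.Theory Num.Theory.
Import numFieldNormedType.Exports.

Local Open Scope classical_set_scope.
Local Open Scope ring_scope.

(** * Densities and the normal distribution *)

(** The law of [X] and the measure induced by [f] agree on every open right ray: both give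
    [1 - F x], the latter by the fundamental theorem of calculus, since a cdf tends to 1 at [+oo].
    These rays are closed under intersection and generate the Borel sets, so the two measures
    coincide. *)
Lemma cdf_has_density (R : realType) (d : measure_display)
    (T : measurableType d) (P : probability T R) (X : {RV P >-> R})
    (F f : R -> R) :
  (forall x, cdf X x = (F x)%:E) -> continuous f -> (forall x, 0 <= f x) ->
  (forall x : R, is_derive x (1 : R) F (f x)) -> has_density X f.
Proof.
move=> XF cf f0 dF; pose mu := @lebesgue_measure R.
have mf : measurable_fun [set: R] f by exact: continuous_measurable_fun.
have F1 : F x @[x --> +oo] --> (1 : R).
  have := cvg_cdfy1 X.
  by rewrite (_ : cdf X = EFin \o F); [move/fine_cvg | apply/funext].
have cF : continuous F.
  move=> x; apply: differentiable_continuous.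
  by apply/derivable1_diffP; have [] := dF x.
split=> // A mA.
pose nu (B : set R) := (\int[mu]_(x in B) (f x)%:E)%E.
have nu0 : nu set0 = 0%E by rewrite /nu integral_set0.
have nu_ge0 (B : set R) : (0 <= nu B)%E.
  by apply: integral_ge0 => x _; rewrite lee_fin.
have nu_sigma : @semi_sigma_additive _ R R nu.
  apply: (@semi_sigma_additive_nng_induced _ (measurableTypeR R) R mu
    (EFin \o f)).
    exact/measurable_EFinP.
  by move=> x; rewrite lee_fin.
pose m : {measure set R -> \bar R} :=
  HB.pack nu (isMeasure.Build _ _ _ _ nu0 nu_ge0 nu_sigma).
suff -> : distribution P X A = m A by [].
have mG : @measurable _ R = <<s @RGenOInfty.G R >>.
  exact: RGenOInfty.measurableE.
(* The rays starting at [- n%:R] exhaust the line, and the law of [X] is finite on each of them. *)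
apply: (@measure_unique _ R R (@RGenOInfty.G R)
  (fun n => `](- n%:R)%R, +oo[%classic) mG _ _ _ (distribution P X) m
  _ _ A mA) => //.
- move=> _ _ [x ->] [y ->]; exists (Num.max x y).
  by apply/seteqP; split=> z /=; rewrite !in_itv/= !andbT gt_max => /andP.
- by move=> n; exists (- n%:R).
- rewrite -subTset => x _; exists (Num.bound `|x|) => //=.
  rewrite in_itv/= andbT ltrNl (le_lt_trans (ler_norm _))// normrN.
  exact/archi_boundP/normr_ge0.
- move=> _ [x ->].
  change (ccdf X x = \int[mu]_(x in `]x, +oo[) (f x)%:E)%E.
  rewrite ccdf_1_cdf XF.
  rewrite integral_itv_obnd_cbnd; last exact/measurable_EFinP/measurable_funTS.
  rewrite (@ge0_continuous_FTC2y _ _ F _ 1)//.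
  + exact: continuous_subspaceT.
  + by apply: cvg_at_right_filter; exact: cF.
  + by move=> y _; rewrite derive1E; have [_ ->] := dF y.
- by move=> k; rewrite (le_lt_trans (probability_le1 _ _)) ?ltry.
Qed.

(** Reflecting the ray to [[- a, +oo[] makes [- expR (- x)] a primitive that vanishes at infinity.
    The value serves to dominate the lower tail of the normal cdf. *)
Lemma integral_expR_ray (R : realType) (a : R) :
  (\int[lebesgue_measure]_(x in `]-oo, a]) (expR x)%:E = (expR a)%:E)%E.
Proof.
rewrite -[in LHS](opprK a) ge0_integration_by_substitutionNy; last 2 first.
- exact/continuous_subspaceT/continuous_expR.
- by move=> x _; exact: expR_ge0.
have dE (x : R) : is_derive x (1 : R) (fun x => - expR (- x)) (expR (- x)).
  have dx := @is_derive1_comp R expR -%R x _ _ (is_derive_expR (- x))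
    (is_deriveNid x 1).
  by apply: (is_derive_eq (is_deriveN dx)); rewrite mulrN1 opprK.
have cE : continuous (fun x : R => expR (- x)).
  by move=> x; apply: continuous_comp;
    [exact: opp_continuous|exact: continuous_expR].
rewrite (@ge0_continuous_FTC2y _ _ (fun x => - expR (- x)) _ 0) /=.
- by rewrite -EFinB sub0r !opprK.
- by move=> x _; exact: expR_ge0.
- exact: continuous_subspaceT.
- by rewrite -oppr0; apply: cvgN; exact: cvgr_expR.
- by move=> x _; have [] := dE x.
- by apply: cvg_at_right_filter; apply: cvgN; exact: cE.
- by move=> x _; rewrite derive1E; have [_ ->] := dE x.
Qed.

Section normal.
Context (R : realType) (m s : R) (s0 : 0 < s).
Local Notation mu := (@lebesgue_measure R).
Local Notation f := (normal_pdf m s).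
Local Notation F := (normal_cdf m s).

Let sN0 : s != 0. Proof. by rewrite gt_eqF. Qed.

Lemma normal_pdf_gt0 x : 0 < f x.
Proof. by rewrite normal_pdfE// mulr_gt0 ?expR_gt0// normal_peak_gt0. Qed.

Lemma normal_cdfE x : (F x)%:E = normal_prob m s `]-oo, x].
Proof. by rewrite /normal_cdf fineK// fin_num_measure. Qed.

Lemma normal_cdf_ge0 x : 0 <= F x.
Proof. by rewrite -lee_fin normal_cdfE. Qed.

Lemma normal_cdf_le1 x : F x <= 1.
Proof. by rewrite -lee_fin normal_cdfE probability_le1. Qed.

Lemma normal_cdf_itv x : 0 <= F x <= 1.
Proof. by rewrite normal_cdf_ge0 normal_cdf_le1. Qed.

Lemma is_derive_normal_cdf (x : R) : is_derive x (1 : R) F (f x).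
Proof.
(* With lower end [-oo] the integral function is [F] itself; [x + 1] is an arbitrary right end
   beyond [x]. *)
have [] := @continuous_FTC1 R f -oo%O x (x + 1) _ _ _ _.
- by rewrite ltrDl.
- by apply: (integrableS _ _ (subsetT _)) => //; exact: integrable_normal_pdf.
- by rewrite ltNyr.
- exact: continuous_normal_pdf.
by move=> dF F'; split; [exact: dF | rewrite -F' derive1E].
Qed.

Lemma continuous_normal_cdf : continuous F.
Proof.
move=> x; apply: differentiable_continuous.
by apply/derivable1_diffP; have [] := is_derive_normal_cdf x.
Qed.

Lemma normal_cdf_increasing (x y : R) : x < y -> F x < F y.
Proof.
move=> xy.
have [] := @MVT R F f x y xy.
- by move=> z _; exact: is_derive_normal_cdf.
- exact/continuous_subspaceT/continuous_normal_cdf.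
by move=> z _ FF; rewrite -subr_gt0 FF mulr_gt0 ?normal_pdf_gt0// subr_gt0.
Qed.

(* Completing the square:
   [(x - m)^2 / (2 s^2) + x = (x - m + s^2)^2 / (2 s^2) + m - s^2 / 2]. *)
Lemma normal_pdf_le_expR x :
  f x <= normal_peak s * expR (s ^+ 2 / 2 - m) * expR x.
Proof.
rewrite normal_pdfE// -mulrA ler_pM2l ?normal_peak_gt0// -expRD ler_expR.
rewrite -mulr_natr.
have -> : - (x - m) ^+ 2 / (s ^+ 2 * 2%:R) =
   (s ^+ 2 / 2 - m + x) - (x - m + s ^+ 2) ^+ 2 / (s ^+ 2 * 2).
  by field.
by rewrite gerBl divr_ge0 ?sqr_ge0// mulr_ge0 ?sqr_ge0.
Qed.

(** Integrate the pointwise bound on the density over []-oo, x]]. This decay at [-oo] is what makes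
    the expected shortfall finite. *)
Lemma normal_cdf_le_expR : exists2 c : R, 0 <= c & forall x, F x <= c * expR x.
Proof.
exists (normal_peak s * expR (s ^+ 2 / 2 - m)).
  by rewrite mulr_ge0 ?normal_peak_ge0 ?expR_ge0.
move=> x; rewrite -lee_fin normal_cdfE EFinM -integral_expR_ray.
rewrite -ge0_integralZl_EFin//=.
- apply: ge0_le_integral => //=.
  + by move=> y _; rewrite lee_fin normal_pdf_ge0.
  + apply/measurable_EFinP; apply: measurable_funTS.
    exact: measurable_normal_pdf.
  + by apply: measurable_funeM; exact/measurable_EFinP/measurable_funTS.
  + by move=> y _; rewrite lee_fin normal_pdf_le_expR.
- by apply/measurable_EFinP; exact: measurable_funTS.
- by rewrite mulr_ge0 ?normal_peak_ge0 ?expR_ge0.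
Qed.

Lemma integrable_normal_cdf_tail (Q : R) :
  mu.-integrable `]-oo, 0%R[ (fun r => (F (r + Q))%:E).
Proof.
have [c c0 Fc] := normal_cdf_le_expR.
have mF : measurable_fun [set: R] (fun r => F (r + Q)).
  apply: (measurableT_comp (continuous_measurable_fun continuous_normal_cdf)).
  exact: measurable_funD.
apply: (@le_integrable _ _ _ mu _ _ _
  (fun r => (c * expR Q)%:E * (expR r)%:E)%E) => //.
- exact/measurable_EFinP/measurable_funTS.
- move=> r _ /=; rewrite lee_fin !ger0_norm ?normal_cdf_ge0//.
    by rewrite -mulrA -expRD addrC.
  by rewrite !mulr_ge0 ?expR_ge0.
apply: integrableZl => //; apply/integrableP; split.
  exact/measurable_EFinP/measurable_funTS.
under eq_integral do rewrite gee0_abs ?lee_fin ?expR_ge0//.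
rewrite (@le_lt_trans _ _ (\int[mu]_(r in `]-oo, 0%R]) (expR r)%:E)%E)//;
  last first.
  by rewrite integral_expR_ray ltry.
apply: ge0_subset_integral => //=.
- by apply/measurable_EFinP; exact: measurable_funTS.
- by move=> x /=; rewrite !in_itv/=; exact: ltW.
Qed.

End normal.

(** * Profit and expected shortfall *)

Section profit.
Context (R : realType) (C M V : R) (hVC : V < C) (hCM : C < M).

Lemma profitE Q x :
  profit C M V Q x = (M - C) * Q - (M - V) * Num.max (Q - x) 0.
Proof.
rewrite /profit; have [xQ|Qx] := leP x Q.
  by rewrite max_l ?subr_ge0//; ring.
by rewrite max_r ?subr_le0 1?ltW//; ring.
Qed.

Lemma profit_nondecreasing Q : nondecreasing_fun (profit C M V Q).
Proof.
move=> x y xy; rewrite !profitE lerD2l lerN2 ler_pM2l;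
  last by rewrite subr_gt0 (lt_trans hVC).
by rewrite ge_max le_max lerD2l lerN2 xy/= le_max lexx orbT.
Qed.

Lemma profit_lowerE Q x y :
  profit_lower C M V Q x y = profit C M V Q (Num.min x y).
Proof.
have mM : Num.min x y <= Num.max x y by rewrite ge_min le_max lexx.
have min_in : profit_range C M V Q x y (profit C M V Q (Num.min x y)).
  by exists (Num.min x y) => //=; rewrite in_itv/= lexx mM.
have lb : lbound (profit_range C M V Q x y) (profit C M V Q (Num.min x y)).
  move=> _ [z /= + <-]; rewrite in_itv/= => /andP[mz _].
  exact: profit_nondecreasing.
apply/eqP; rewrite eq_le; apply/andP; split.
- by apply: ge_inf => //; exists (profit C M V Q (Num.min x y)).
- by apply: lb_le_inf => //; exists (profit C M V Q (Num.min x y)).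
Qed.

Lemma profit_upperE Q x y :
  profit_upper C M V Q x y = profit C M V Q (Num.max x y).
Proof.
have mM : Num.min x y <= Num.max x y by rewrite ge_min le_max lexx.
have max_in : profit_range C M V Q x y (profit C M V Q (Num.max x y)).
  by exists (Num.max x y) => //=; rewrite in_itv/= lexx mM.
have ub : ubound (profit_range C M V Q x y) (profit C M V Q (Num.max x y)).
  move=> _ [z /= + <-]; rewrite in_itv/= => /andP[_ zM].
  exact: profit_nondecreasing.
apply/eqP; rewrite eq_le; apply/andP; split.
- by apply: ge_sup => //; exists (profit C M V Q (Num.max x y)).
- by apply: ub_le_sup => //; exists (profit C M V Q (Num.max x y)).
Qed.

End profit.

(* The integral of [F] over [(-oo, Q]], shifted to the half-line on which
   [le0_expectation_cdf] integrates. *)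
Definition cdf_tail (R : realType) (F : R -> R) (Q : R) : R :=
  \int[@lebesgue_measure R]_(r in `]-oo, 0%R[) F (r + Q).

Definition integrable_tail (R : realType) (F : R -> R) (Q : R) : Prop :=
  (@lebesgue_measure R).-integrable `]-oo, 0%R[ (fun r => (F (r + Q))%:E).

Section expected_profit.
Context (R : realType) (d : measure_display) (T : measurableType d)
  (P : probability T R) (Z : {RV P >-> R}) (F : R -> R).
Hypothesis ZF : forall x, cdf Z x = (F x)%:E.
Local Notation mu := (@lebesgue_measure R).

Let shortfall (Q : R) (w : T) : R := Num.max (Q - Z w) 0.

Let shortfall_ge0 Q w : 0 <= shortfall Q w.
Proof. by rewrite /shortfall le_max lexx orbT. Qed.

Let measurable_shortfall Q : measurable_fun [set: T] (shortfall Q).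
Proof. by apply: measurable_maxr => //; exact: measurable_funB. Qed.

(** The expectation formula for nonpositive variables, applied to the opposite of the shortfall: for
    [r < 0] the event [- shortfall Q w <= r] is [Z w <= r + Q]. *)
Let expectation_shortfall Q :
  (\int[P]_w (shortfall Q w)%:E = \int[mu]_(r in `]-oo, 0%R[) (F (r + Q))%:E)%E.
Proof.
have mW : measurable_fun [set: T] (fun w => - shortfall Q w).
  exact: measurableT_comp.
pose W : {RV P >-> R} :=
  HB.pack (fun w => - shortfall Q w) (isMeasurableFun.Build _ _ _ _ _ mW).
transitivity (- 'E_P[W])%E.
  rewrite expectation_def /=.
  rewrite (@integral_ge0N _ _ _ P setT (fun w => (shortfall Q w)%:E)).
    by rewrite oppeK.
  move=> w _.
  by rewrite lee_fin.
rewrite (@le0_expectation_cdf _ _ _ P W) => [|w]; last by rewrite /= oppr_le0.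
rewrite oppeK; apply: eq_integral => r; rewrite inE/= in_itv/= => r0.
rewrite -ZF /cdf /distribution /pushforward; congr (P _).
suff e w : (- shortfall Q w <= r) = (Z w <= r + Q).
  by apply/seteqP; split => w /=; rewrite !in_itv/= e.
(* As [r < 0], the term 0 of the maximum cannot reach [- r]. *)
rewrite /shortfall lerNl le_max oppr_le0 (leNgt 0) r0 orbF.
by apply/idP/idP; lra.
Qed.

Let expectation_shortfallE Q : integrable_tail F Q ->
  (\int[P]_w (shortfall Q w)%:E = (cdf_tail F Q)%:E)%E.
Proof.
move=> iF; rewrite expectation_shortfall /cdf_tail /Rintegral fineK//.
exact: integrable_fin_num.
Qed.

Let integrable_shortfall Q : integrable_tail F Q ->
  P.-integrable [set: T] (EFin \o shortfall Q).
Proof.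
move=> iF; apply/integrableP; split; first exact/measurable_EFinP.
under eq_integral do rewrite /= ger0_norm//.
by rewrite expectation_shortfallE// ltry.
Qed.

Lemma expectation_profit (C M V Q : R) : integrable_tail F Q ->
  'E_P[fun w => profit C M V Q (Z w)]%E =
    ((M - C) * Q - (M - V) * cdf_tail F Q)%:E.
Proof.
move=> iF; have intS := integrable_shortfall iF.
have intA : P.-integrable [set: T]
    (fun w => (M - V)%:E * (shortfall Q w)%:E)%E.
  exact: integrableZl.
have intc : P.-integrable [set: T] (cst ((M - C) * Q)%:E).
  exact: finite_measure_integrable_cst.
rewrite unlock; under eq_integral do rewrite profitE EFinB (EFinM (M - V)).
rewrite integralB//= integralZl//= integral_cst//= probability_setT mule1.
by rewrite -[X in (_ - _ * X)%E]/(\int[P]_w (shortfall Q w)%:E)%E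
  expectation_shortfallE.
Qed.

(** Raising the order from [Q] to [Q'] increases the shortfall by at least [Q' - Q] where [Z <= Q],
    by at most [Q' - Q] where [Z <= Q'], and by 0 elsewhere; integrate. So [F] gives the slopes of
    the convex function [cdf_tail F], which replaces differentiation under the integral. *)
Lemma cdf_tail_slope Q Q' : integrable_tail F Q -> integrable_tail F Q' ->
  Q < Q' -> (Q' - Q) * F Q <= cdf_tail F Q' - cdf_tail F Q <= (Q' - Q) * F Q'.
Proof.
move=> iQ iQ' QQ'.
have mZ q : measurable (Z @^-1` `]-oo, q]) by exact: measurable_funPTI.
(* Both bounds are added to the shortfall at [Q], with [q] equal to [Q] or [Q'], so that only
   nonnegative functions are integrated. *)
have E1 q : (\int[P]_w ((shortfall Q w)%:E
      + (Q' - Q)%:E * (\1_(Z @^-1` `]-oo, q]) w)%:E)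
    = (cdf_tail F Q + (Q' - Q) * F q)%:E)%E.
  rewrite ge0_integralD//=; last 4 first.
  - by move=> w _; rewrite lee_fin.
  - exact/measurable_EFinP.
  - by move=> w _; rewrite -EFinM lee_fin mulr_ge0// subr_ge0 ltW.
  - by apply: measurable_funeM; exact/measurable_EFinP/measurable_indic.
  rewrite expectation_shortfallE// ge0_integralZl_EFin//=; last 2 first.
  - exact/measurable_EFinP/measurable_indic.
  - by rewrite subr_ge0 ltW.
  by rewrite integral_indic// setIT -?EFinB [in RHS]EFinD [in RHS]EFinM -ZF.
have mE q : measurable_fun [set: T]
    (fun w => (shortfall Q w)%:E + (Q' - Q)%:E * (\1_(Z @^-1` `]-oo, q]) w)%:E)%E.
  apply: emeasurable_funD; first exact/measurable_EFinP.
  by apply: measurable_funeM; exact/measurable_EFinP/measurable_indic.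
have e_ge0 q w :
    (0 <= (shortfall Q w)%:E + (Q' - Q)%:E * (\1_(Z @^-1` `]-oo, q]) w)%:E)%E.
  by rewrite -EFinM -EFinD lee_fin addr_ge0// mulr_ge0// subr_ge0 ltW.
apply/andP; split.
- rewrite lerBrDl -lee_fin -E1 -expectation_shortfallE//; apply: ge0_le_integral => //=.
  + exact/measurable_EFinP.
  + move=> w _; rewrite -EFinM -EFinD lee_fin indicE /shortfall.
    have [|] := boolP (w \in _); rewrite ?inE ?notin_setE/= in_itv/=.
      by move=> zQ;
        have [?|?] := leP (Q - Z w) 0; have [?|?] := leP (Q' - Z w) 0; lra.
    by move=> /negP; rewrite -ltNge => zQ;
      have [?|?] := leP (Q - Z w) 0; have [?|?] := leP (Q' - Z w) 0; lra.
- rewrite lerBlDl -lee_fin -E1 -expectation_shortfallE//; apply: ge0_le_integral => //=.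
  + by move=> w _; rewrite lee_fin.
  + exact/measurable_EFinP.
  + move=> w _; rewrite -EFinM -EFinD lee_fin indicE /shortfall.
    have [|] := boolP (w \in _); rewrite ?inE ?notin_setE/= in_itv/=.
      by move=> zQ;
        have [?|?] := leP (Q - Z w) 0; have [?|?] := leP (Q' - Z w) 0; lra.
    by move=> /negP; rewrite -ltNge => zQ;
      have [?|?] := leP (Q - Z w) 0; have [?|?] := leP (Q' - Z w) 0; lra.
Qed.

End expected_profit.

(** * The critical fractile *)

(** The slope [b - A * F] of the objective is positive before [Q0] and negative after it. *)
Lemma critical_fractile_maximizer (R : realType) (A b : R) (F G : R -> R) (Q0 : R) :
  0 < A -> {homo F : x y / x < y} ->
  (forall Q Q', Q < Q' -> (Q' - Q) * F Q <= G Q' - G Q <= (Q' - Q) * F Q') ->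
  A * F Q0 = b ->
  forall Q, (forall Q', b * Q' - A * G Q' <= b * Q - A * G Q) <-> Q = Q0.
Proof.
move=> A0 Fi slope FQ0 Q.
have max_lt q : q != Q0 -> b * q - A * G q < b * Q0 - A * G Q0.
  (* The slope bound on the whole interval between [q] and [Q0] may involve [F Q0] and then yields
     only a weak inequality. Cutting at the midpoint [m] gives strictness on the half next to [q],
     where [F m] differs strictly from [F Q0]. *)
  rewrite neq_lt => /orP[] lt_q; pose m := (q + Q0) / 2.
  - have qm : q < m by rewrite /m; lra.
    have mQ : m < Q0 by rewrite /m; lra.
    have /andP[_ s1] := slope _ _ qm; have /andP[_ s2] := slope _ _ mQ.
    have := Fi _ _ mQ; rewrite -(ltr_pM2l A0) FQ0 => Fm.
    have h1 : A * (G m - G q) <= (m - q) * (A * F m) by rewrite mulrCA ler_pM2l.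
    have h2 : A * (G Q0 - G m) <= (Q0 - m) * b by rewrite -FQ0 mulrCA ler_pM2l.
    have h3 : (m - q) * (A * F m) < (m - q) * b by rewrite ltr_pM2l// subr_gt0.
    by lra.
  - have qm : m < q by rewrite /m; lra.
    have mQ : Q0 < m by rewrite /m; lra.
    have /andP[s1 _] := slope _ _ qm; have /andP[s2 _] := slope _ _ mQ.
    have := Fi _ _ mQ; rewrite -(ltr_pM2l A0) FQ0 => Fm.
    have h1 : (q - m) * (A * F m) <= A * (G q - G m) by rewrite mulrCA ler_pM2l.
    have h2 : (m - Q0) * b <= A * (G m - G Q0) by rewrite -FQ0 mulrCA ler_pM2l.
    have h3 : (q - m) * b < (q - m) * (A * F m) by rewrite ltr_pM2l// subr_gt0.
    by lra.
split=> [Qmax|-> q].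
  by apply/eqP; apply/negPn/negP => /max_lt; rewrite ltNge Qmax.
by have [->//|/max_lt/ltW] := eqVneq q Q0.
Qed.

(** * Quadratic combinations of two cdfs *)

(** A family that contains the demand cdf and the cdfs of the minimum and maximum of two mixtures.
    It is linear in its coefficients, so all their tail integrals are combinations of the same five
    numbers. *)
Definition quadratic_comb (R : realType) (c1 c2 c11 c12 c22 : R)
    (F1 F2 : R -> R) (x : R) : R :=
  c1 * F1 x + c2 * F2 x
  + (c11 * F1 x ^+ 2 + c12 * (F1 x * F2 x) + c22 * F2 x ^+ 2).

Lemma is_derive_quadratic_comb (R : realType) (c1 c2 c11 c12 c22 : R)
    (F1 F2 : R -> R) (x d1 d2 : R) :
  is_derive x (1 : R) F1 d1 -> is_derive x (1 : R) F2 d2 ->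
  is_derive x (1 : R) (quadratic_comb c1 c2 c11 c12 c22 F1 F2)
    (d1 * (c1 + 2 * c11 * F1 x + c12 * F2 x)
     + d2 * (c2 + c12 * F1 x + 2 * c22 * F2 x)).
Proof.
move=> dF1 dF2.
have dq := is_deriveD
  (is_deriveD (is_deriveZ c1 dF1) (is_deriveZ c2 dF2))
  (is_deriveD (is_deriveD (is_deriveZ c11 (is_deriveM dF1 dF1))
     (is_deriveZ c12 (is_deriveM dF1 dF2)))
     (is_deriveZ c22 (is_deriveM dF2 dF2))).
by apply: (is_derive_eq dq); rewrite /GRing.scale/=; ring.
Qed.

Section quadratic_tail.
Context (R : realType) (F1 F2 : R -> R) (Q : R).
Local Notation mu := (@lebesgue_measure R).
Hypothesis F1_01 : forall x, 0 <= F1 x <= 1.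
Hypothesis F2_01 : forall x, 0 <= F2 x <= 1.
Hypothesis cF1 : continuous F1.
Hypothesis cF2 : continuous F2.
Hypothesis iF1 : integrable_tail F1 Q.
Hypothesis iF2 : integrable_tail F2 Q.

Let integrable_tailZ c F : integrable_tail F Q ->
  integrable_tail (fun x => c * F x) Q.
Proof.
by move=> iF; exact: (integrableZl _ c iF).
Qed.

Let integrable_tailD F G : integrable_tail F Q -> integrable_tail G Q ->
  integrable_tail (fun x => F x + G x) Q.
Proof.
by move=> iF iG; exact: (integrableD _ iF iG).
Qed.

(** A factor with values in [0, 1] leaves the product dominated by [G]. *)
Let integrable_tail_mul (F G : R -> R) : continuous F -> continuous G ->
  (forall x, 0 <= F x <= 1) -> (forall x, 0 <= G x <= 1) ->
  integrable_tail G Q -> integrable_tail (fun x => F x * G x) Q.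
Proof.
move=> cF cG F01 G01; apply: le_integrable => //.
- apply/measurable_EFinP; apply: measurable_funTS.
  have mQ : measurable_fun [set: R] (fun r => r + Q) by exact: measurable_funD.
  apply: measurable_funM.
    exact: (measurableT_comp (continuous_measurable_fun cF)).
  exact: (measurableT_comp (continuous_measurable_fun cG)).
- move=> r _ /=; rewrite lee_fin normrM.
  have /andP[F0 F1'] := F01 (r + Q); have /andP[G0 _] := G01 (r + Q).
  by rewrite !ger0_norm// ler_piMl.
Qed.

Let cdf_tailZ c F : integrable_tail F Q ->
  cdf_tail (fun x => c * F x) Q = c * cdf_tail F Q.
Proof. by move=> iF; rewrite /cdf_tail RintegralZl. Qed.

Let cdf_tailD F G : integrable_tail F Q -> integrable_tail G Q ->
  cdf_tail (fun x => F x + G x) Q = cdf_tail F Q + cdf_tail G Q.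
Proof. by move=> iF iG; rewrite /cdf_tail RintegralD. Qed.

Let i11 : integrable_tail (fun x => F1 x ^+ 2) Q.
Proof. exact: integrable_tail_mul. Qed.

Let i12 : integrable_tail (fun x => F1 x * F2 x) Q.
Proof. exact: integrable_tail_mul. Qed.

Let i22 : integrable_tail (fun x => F2 x ^+ 2) Q.
Proof. exact: integrable_tail_mul. Qed.

Lemma integrable_tail_quadratic_comb c1 c2 c11 c12 c22 :
  integrable_tail (quadratic_comb c1 c2 c11 c12 c22 F1 F2) Q.
Proof. by do ![apply: integrable_tailD | apply: integrable_tailZ]. Qed.

Lemma cdf_tail_quadratic_comb c1 c2 c11 c12 c22 :
  cdf_tail (quadratic_comb c1 c2 c11 c12 c22 F1 F2) Q =
  c1 * cdf_tail F1 Q + c2 * cdf_tail F2 Q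
  + (c11 * cdf_tail (fun x => F1 x ^+ 2) Q
     + c12 * cdf_tail (fun x => F1 x * F2 x) Q
     + c22 * cdf_tail (fun x => F2 x ^+ 2) Q).
Proof.
rewrite /quadratic_comb !cdf_tailD ?cdf_tailZ//;
  by do ![apply: integrable_tailD | apply: integrable_tailZ].
Qed.

End quadratic_tail.

(** * Averaging over the alpha-cuts *)

(** This is the origin of [coefP1]: it is twice the average over alpha of the product of the two cut
    ends. The integrand is quadratic in alpha, with the coefficients [a], [b], [c] below and
    primitive [G]. *)
Lemma integral_cut_polynomial (R : realType) (p1 p2 p3 p4 K L N : R) :
  (\int[lebesgue_measure]_(alpha in `[0%R, 1%R])
    (K + L * (cut_left p1 p2 alpha + cut_right p3 p4 alpha)
     + N * (cut_left p1 p2 alpha * cut_right p3 p4 alpha))%:E =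
  (K + L * ((p1 + p2 + p3 + p4) / 2) + N * (coefP1 p1 p2 p3 p4 / 2))%:E)%E.
Proof.
pose a := K + L * (p1 + p4) + N * (p1 * p4).
pose b := L * (p2 - p1 + p3 - p4) + N * (p1 * (p3 - p4) + p4 * (p2 - p1)).
pose c := N * ((p2 - p1) * (p3 - p4)).
(* [G] is built with operations on functions so that the derivation rules apply to it as it stands;
   [GE] is its pointwise form. *)
pose G := (a \*: @idfun R + (b / 2) \*: (@idfun R ^+ 2)
  + (c / 3) \*: (@idfun R ^+ 3)) : R -> R.
have GE x : G x = a * x + b / 2 * x ^+ 2 + c / 3 * x ^+ 3 by [].
pose g (x : R) := a + b * x + c * x ^+ 2.
have dG (x : R) : is_derive x (1 : R) G (g x).
  have dx := is_derive_id x (1 : R).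
  have dq := is_deriveD (is_deriveD (is_deriveZ a dx)
    (is_deriveZ (b / 2) (is_deriveX 2 dx))) (is_deriveZ (c / 3) (is_deriveX 3 dx)).
  apply: (is_derive_eq dq); rewrite /GRing.scale /g /=.
  by field.
have cG : continuous G.
  move=> x; apply: differentiable_continuous.
  by apply/derivable1_diffP; have [] := dG x.
have cg : continuous g.
  move=> x; apply: cvgD; first apply: cvgD; first exact: cvg_cst.
    by apply: cvgM; [exact: cvg_cst|exact: cvg_id].
  by apply: cvgM; [exact: cvg_cst|exact: exprn_continuous].
transitivity (\int[lebesgue_measure]_(x in `[0%R, 1%R]) (g x)%:E)%E.
  apply: eq_integral => x _; congr EFin.
  by rewrite /g /a /b /c /cut_left /cut_right; ring.
rewrite (@continuous_FTC2 _ g G)//.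
- by rewrite -EFinB; congr EFin; rewrite !GE /a /b /c /coefP1; field.
- exact: continuous_subspaceT.
- split.
  + by move=> x _; have [] := dG x.
  + by apply: cvg_at_right_filter; exact: cG.
  + by apply: cvg_at_left_filter; exact: cG.
- by move=> x _; rewrite derive1E; have [_ ->] := dG x.
Qed.

(** * Cdfs of mixtures and of extrema of independent variables *)

Lemma cdf_mixture (R : realType) (d : measure_display) (T : measurableType d)
    (P : probability T R) (X : {RV P >-> R}) (p mu1 mu2 s1 s2 x : R) :
  0 <= p <= 1 ->
  has_density X (mixture_pdf p (normal_pdf mu1 s1) (normal_pdf mu2 s2)) ->
  cdf X x = (p * normal_cdf mu1 s1 x + (1 - p) * normal_cdf mu2 s2 x)%:E.
Proof.
move=> /andP[p0 p1] [_ _ dX]; rewrite /cdf dX//.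
have mf m s c : measurable_fun `]-oo, x]
    (fun y => (c%:E * (normal_pdf m s y)%:E)%E).
  apply: measurable_funeM; apply/measurable_EFinP; apply: measurable_funTS.
  exact: measurable_normal_pdf.
have mn m s : measurable_fun `]-oo, x] (EFin \o normal_pdf m s).
  by apply/measurable_EFinP; apply: measurable_funTS; exact: measurable_normal_pdf.
have p1' : 0 <= 1 - p by rewrite subr_ge0.
under eq_integral do rewrite /mixture_pdf EFinD !EFinM.
rewrite ge0_integralD//=; last 4 first.
- by move=> y _; rewrite -EFinM lee_fin mulr_ge0 ?normal_pdf_ge0.
- exact: mf.
- by move=> y _; rewrite -EFinM lee_fin mulr_ge0 ?normal_pdf_ge0.
- exact: mf.
rewrite !ge0_integralZl_EFin//=; last 4 first.
- by move=> y _; rewrite lee_fin normal_pdf_ge0.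
- exact: mn.
- by move=> y _; rewrite lee_fin normal_pdf_ge0.
- exact: mn.
by rewrite [RHS]EFinD !EFinM !normal_cdfE.
Qed.

Section extrema.
Context (R : realType) (d : measure_display) (T : measurableType d)
  (P : probability T R) (X Y : {RV P >-> R}) (F G : R -> R).
Hypothesis XF : forall x, cdf X x = (F x)%:E.
Hypothesis YG : forall x, cdf Y x = (G x)%:E.
Hypothesis XY : independent_RV X Y.

(** The maximum is at most [x] exactly when both variables are, so independence gives a product. It
    is packaged as a random variable to fit [expectation_profit]. *)
Lemma cdf_max_independent : exists Z : {RV P >-> R},
  (forall w, Z w = Num.max (X w) (Y w)) /\
  forall x, cdf Z x = (F x * G x)%:E.
Proof.
have mZ : measurable_fun [set: T] (fun w => Num.max (X w) (Y w)).
  exact: measurable_maxr.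
pose Z : {RV P >-> R} := HB.pack (fun w => Num.max (X w) (Y w))
  (isMeasurableFun.Build _ _ _ _ _ mZ).
exists Z; split=> // x.
rewrite EFinM -XF -YG /cdf /distribution /pushforward -XY//; congr (P _).
by apply/seteqP; split => w /=; rewrite !in_itv/= ge_max => /andP.
Qed.

(** The minimum is at most [x] on the union of the two events; apply inclusion-exclusion. *)
Lemma cdf_min_independent : exists Z : {RV P >-> R},
  (forall w, Z w = Num.min (X w) (Y w)) /\
  forall x, cdf Z x = (F x + G x - F x * G x)%:E.
Proof.
have mZ : measurable_fun [set: T] (fun w => Num.min (X w) (Y w)).
  exact: measurable_minr.
pose Z : {RV P >-> R} := HB.pack (fun w => Num.min (X w) (Y w))
  (isMeasurableFun.Build _ _ _ _ _ mZ).
exists Z; split=> // x.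
have mI (U : {RV P >-> R}) : measurable (U @^-1` `]-oo, x]).
  exact: measurable_funPTI.
rewrite EFinB EFinD EFinM -XF -YG /cdf /distribution /pushforward -XY//.
transitivity (P ((X @^-1` `]-oo, x]) `|` (Y @^-1` `]-oo, x]))).
  congr (P _); apply/seteqP; split => w /=; rewrite !in_itv/= ge_min.
    by move=> /orP.
  by move=> ?; apply/orP.
by rewrite measureUfinr// -ge0_fin_numE// fin_num_measure.
Qed.

End extrema.

(** * The demand and the defuzzified profit *)

Section coefficients.
Context (R : realType) (p1 p2 p3 p4 : R).
Hypotheses (hp1 : 0 <= p1) (hp12 : p1 <= p2) (hp23 : p2 <= p3) (hp34 : p3 <= p4)
  (hp4 : p4 <= 1).

(** With [u] and [v] the two cut ends, [coefP1], [coefP2] and [coefP3] are the integrals over alpha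
    in [0, 1] of [2uv], [u(1 - v) + v(1 - u)] and [2(1 - u)(1 - v)]. This explains their signs and
    their weighted sum 2. *)
Lemma coefP1_ge0 : 0 <= coefP1 p1 p2 p3 p4.
Proof. rewrite /coefP1; move: hp1 hp12 hp23 hp34 hp4 => *; nra. Qed.

(** [coefP2] is the average of [u + v - 2uv = u(1 - v) + v(1 - u)] with weight 1/6 on the pairs
    [(p1, p3)], [(p2, p4)] and 1/3 on [(p1, p4)], [(p2, p3)]. *)
Lemma coefP2_ge0 : 0 <= coefP2 p1 p2 p3 p4.
Proof.
have h u v : 0 <= u <= 1 -> 0 <= v <= 1 -> 0 <= u + v - 2 * (u * v) :> R.
  by move=> /andP[? ?] /andP[? ?]; nra.
move: hp1 hp12 hp23 hp34 hp4 => *.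
have h1 : 0 <= p1 <= 1 by lra.
have h2 : 0 <= p2 <= 1 by lra.
have h3 : 0 <= p3 <= 1 by lra.
have h4 : 0 <= p4 <= 1 by lra.
have := h _ _ h1 h3; have := h _ _ h1 h4; have := h _ _ h2 h3; have := h _ _ h2 h4.
by rewrite /coefP2; lra.
Qed.

(** The same pairs with doubled weights, now applied to [(1 - u)(1 - v)]. *)
Lemma coefP3_ge0 : 0 <= coefP3 p1 p2 p3 p4.
Proof.
have h u v : u <= 1 -> v <= 1 -> 0 <= 1 - u - v + u * v :> R.
  by move=> ? ?; nra.
move: hp1 hp12 hp23 hp34 hp4 => *.
have h1 : p1 <= 1 by lra.
have h2 : p2 <= 1 by lra.
have h3 : p3 <= 1 by lra.
have := h _ _ h1 h3; have := h _ _ h1 hp4.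
have := h _ _ h2 h3; have := h _ _ h2 hp4.
by rewrite /coefP3; lra.
Qed.

Lemma coefP_sum :
  coefP1 p1 p2 p3 p4 + 2 * coefP2 p1 p2 p3 p4 + coefP3 p1 p2 p3 p4 = 2.
Proof. by rewrite /coefP1 /coefP2 /coefP3; field. Qed.

Lemma cut_left_itv alpha : 0 <= alpha <= 1 -> 0 <= cut_left p1 p2 alpha <= 1.
Proof.
move: hp1 hp12 hp23 hp34 hp4 => ? ? ? ? ? /andP[? ?]; rewrite /cut_left.
by apply/andP; split; nra.
Qed.

Lemma cut_right_itv alpha : 0 <= alpha <= 1 -> 0 <= cut_right p3 p4 alpha <= 1.
Proof.
move: hp1 hp12 hp23 hp34 hp4 => ? ? ? ? ? /andP[? ?]; rewrite /cut_right.
by apply/andP; split; nra.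
Qed.

End coefficients.

(** Writing [2 * beta - 1] as [beta - (1 - beta)] brings the factors of [f1] and [f2] in the demand
    density to this form. *)
Lemma convex_weight_ge0 (R : realType) (beta a b u v : R) :
  0 <= beta <= 1 -> 0 <= a -> 0 <= b -> 0 <= u <= 1 -> 0 <= v <= 1 ->
  0 <= beta * (a * u + b * v) + (1 - beta) * (a * (1 - u) + b * (1 - v)).
Proof.
move=> /andP[b0 b1] a0 bb0 /andP[u0 u1] /andP[v0 v1].
by rewrite addr_ge0// mulr_ge0 ?subr_ge0// addr_ge0// mulr_ge0 ?subr_ge0.
Qed.

(** * The demand distribution *)

Section demand.
Context (R : realType) (P1 P2 P3 beta : R) (F1 F2 : R -> R).
Hypotheses (P1_ge0 : 0 <= P1) (P2_ge0 : 0 <= P2) (P3_ge0 : 0 <= P3)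
  (P_sum : P1 + 2 * P2 + P3 = 2) (beta01 : 0 <= beta <= 1).

Lemma demand_cdfE : demand_cdf P1 P2 P3 beta F1 F2 =
  quadratic_comb ((1 - beta) * (P1 + P2)) ((1 - beta) * (P2 + P3))
    ((2 * beta - 1) * P1 / 2) ((2 * beta - 1) * P2) ((2 * beta - 1) * P3 / 2)
    F1 F2.
Proof.
by apply/funext => x; rewrite /demand_cdf /funH /funJ /quadratic_comb; field.
Qed.

Lemma is_derive_demand_cdf (f1 f2 : R -> R) (x : R) :
  is_derive x (1 : R) F1 (f1 x) -> is_derive x (1 : R) F2 (f2 x) ->
  is_derive x (1 : R) (demand_cdf P1 P2 P3 beta F1 F2)
    (demand_pdf P1 P2 P3 beta f1 f2 F1 F2 x).
Proof.
move=> dF1 dF2; rewrite demand_cdfE.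
apply: (is_derive_eq (is_derive_quadratic_comb _ _ _ _ _ dF1 dF2)).
by rewrite /demand_pdf; field.
Qed.

Lemma continuous_demand_pdf (f1 f2 : R -> R) (x : R) :
  {for x, continuous f1} -> {for x, continuous f2} ->
  {for x, continuous F1} -> {for x, continuous F2} ->
  {for x, continuous (demand_pdf P1 P2 P3 beta f1 f2 F1 F2)}.
Proof.
move=> cf1 cf2 cF1 cF2.
have cZ (c : R) f : {for x, continuous f} -> {for x, continuous (fun y => c * f y)}.
  by move=> cf; apply: cvgM; [exact: cvg_cst | exact: cf].
have cL c1 c2 (f g : R -> R) : {for x, continuous f} -> {for x, continuous g} ->
    {for x, continuous (fun y => c1 * f y + c2 * g y)}.
  by move=> cf cg; apply: cvgD; exact: cZ.
have cM (f g : R -> R) : {for x, continuous f} -> {for x, continuous g} ->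
    {for x, continuous (fun y => f y * g y)}.
  by move=> cf cg; apply: cvgM; [exact: cf | exact: cg].
apply: cvgD; apply: cZ; last exact: cL.
by apply: cvgD; apply: cM => //; exact: cL.
Qed.

Lemma demand_pdf_ge0 (f1 f2 : R -> R) (x : R) :
  0 <= f1 x -> 0 <= f2 x -> 0 <= F1 x <= 1 -> 0 <= F2 x <= 1 ->
  0 <= demand_pdf P1 P2 P3 beta f1 f2 F1 F2 x.
Proof.
move=> f10 f20 F1x F2x.
have h1 := convex_weight_ge0 beta01 P1_ge0 P2_ge0 F1x F2x.
have h2 := convex_weight_ge0 beta01 P2_ge0 P3_ge0 F1x F2x.
rewrite (_ : demand_pdf _ _ _ _ _ _ _ _ _ =
  f1 x * (beta * (P1 * F1 x + P2 * F2 x)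
    + (1 - beta) * (P1 * (1 - F1 x) + P2 * (1 - F2 x)))
  + f2 x * (beta * (P2 * F1 x + P3 * F2 x)
    + (1 - beta) * (P2 * (1 - F1 x) + P3 * (1 - F2 x)))).
  by rewrite addr_ge0// mulr_ge0.
by rewrite /demand_pdf; ring.
Qed.

(* The increment of the quadratic form is its gradient at the midpoint applied
   to the increments of [F1] and [F2]. *)
Lemma demand_cdf_increasing (x y : R) : F1 x < F1 y -> F2 x < F2 y ->
  0 <= F1 x -> F1 y <= 1 -> 0 <= F2 x -> F2 y <= 1 ->
  demand_cdf P1 P2 P3 beta F1 F2 x < demand_cdf P1 P2 P3 beta F1 F2 y.
Proof.
move=> F1xy F2xy F1x F1y F2x F2y.
pose u := (F1 x + F1 y) / 2; pose v := (F2 x + F2 y) / 2.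
have u01 : 0 < u < 1 by rewrite /u; lra.
have v01 : 0 < v < 1 by rewrite /v; lra.
pose g1 := beta * (P1 * u + P2 * v) + (1 - beta) * (P1 * (1 - u) + P2 * (1 - v)).
pose g2 := beta * (P2 * u + P3 * v) + (1 - beta) * (P2 * (1 - u) + P3 * (1 - v)).
have u01' : 0 <= u <= 1 by lra.
have v01' : 0 <= v <= 1 by lra.
have g1_ge0 : 0 <= g1 by exact: convex_weight_ge0.
have g2_ge0 : 0 <= g2 by exact: convex_weight_ge0.
have g_gt0 : 0 < g1 + g2.
  (* Replacing each of [u], [v], [1 - u], [1 - v] by a common positive lower bound [m] turns
     [g1 + g2] into [2 * m], because of [P_sum]; hence [g1 + g2 >= 2 * m]. *)
  have [m [m0 mu mv mu' mv']] : exists m : R,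
      [/\ 0 < m, m <= u, m <= v, m <= 1 - u & m <= 1 - v].
    exists (Num.min (Num.min u v) (Num.min (1 - u) (1 - v))).
    rewrite !lt_min !ge_min !lexx ?orbT; split=> //.
    by move: u01 v01 => /andP[-> ?] /andP[-> ?]; rewrite !subr_gt0 /=; apply/andP.
  have [b0 b1] := andP beta01.
  have e : g1 + g2 - 2 * m =
      beta * ((P1 + P2) * (u - m) + (P2 + P3) * (v - m))
      + (1 - beta) * ((P1 + P2) * (1 - u - m) + (P2 + P3) * (1 - v - m)).
    rewrite -P_sum /g1 /g2; ring.
  have : 0 <= g1 + g2 - 2 * m.
    have P12 := addr_ge0 P1_ge0 P2_ge0; have P23 := addr_ge0 P2_ge0 P3_ge0.
    by rewrite e; apply: addr_ge0; (apply: mulr_ge0; first by rewrite ?subr_ge0);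
      apply: addr_ge0; apply: mulr_ge0; rewrite ?subr_ge0.
  by rewrite subr_ge0; apply: lt_le_trans; rewrite mulr_gt0.
rewrite -subr_gt0.
rewrite (_ : _ - _ = (F1 y - F1 x) * g1 + (F2 y - F2 x) * g2); last first.
  by rewrite /demand_cdf /funH /funJ /g1 /g2 /u /v; field.
(* Only the sum is known to be positive, so either gradient component may vanish. *)
have [g10|g10] := eqVneq g1 0.
  rewrite g10 mulr0 add0r mulr_gt0 ?subr_gt0//.
  by rewrite g10 add0r in g_gt0.
apply: ltr_wpDr; first by rewrite mulr_ge0// subr_ge0 ltW.
by rewrite mulr_gt0 ?subr_gt0// lt_neqAle eq_sym g10.
Qed.

End demand.

Section normal_tails.
Context (R : realType) (mu1 mu2 s1 s2 : R) (hs1 : 0 < s1) (hs2 : 0 < s2).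
Local Notation F1 := (normal_cdf mu1 s1).
Local Notation F2 := (normal_cdf mu2 s2).

Lemma integrable_tail_normal_comb c1 c2 c11 c12 c22 Q :
  integrable_tail (quadratic_comb c1 c2 c11 c12 c22 F1 F2) Q.
Proof.
apply: integrable_tail_quadratic_comb.
- exact: normal_cdf_itv.
- exact: normal_cdf_itv.
- exact: continuous_normal_cdf.
- exact: continuous_normal_cdf.
- exact: integrable_normal_cdf_tail.
- exact: integrable_normal_cdf_tail.
Qed.

Lemma cdf_tail_normal_comb c1 c2 c11 c12 c22 Q :
  cdf_tail (quadratic_comb c1 c2 c11 c12 c22 F1 F2) Q =
  c1 * cdf_tail F1 Q + c2 * cdf_tail F2 Q
  + (c11 * cdf_tail (fun x => F1 x ^+ 2) Q
     + c12 * cdf_tail (fun x => F1 x * F2 x) Q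
     + c22 * cdf_tail (fun x => F2 x ^+ 2) Q).
Proof.
apply: cdf_tail_quadratic_comb.
- exact: normal_cdf_itv.
- exact: normal_cdf_itv.
- exact: continuous_normal_cdf.
- exact: continuous_normal_cdf.
- exact: integrable_normal_cdf_tail.
- exact: integrable_normal_cdf_tail.
Qed.

End normal_tails.

(** * The defuzzified profit in closed form *)

Section defuzzified.
Context (R : realType) (C M V : R) (hVC : V < C) (hCM : C < M)
  (mu1 mu2 s1 s2 : R) (hs1 : 0 < s1) (hs2 : 0 < s2)
  (p1 p2 p3 p4 : R) (hp1 : 0 <= p1) (hp12 : p1 <= p2) (hp23 : p2 <= p3)
  (hp34 : p3 <= p4) (hp4 : p4 <= 1) (beta : R)
  (d : measure_display) (T : measurableType d) (P : probability T R)
  (X1 X2 : R -> {RV P >-> R}).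
Local Notation F1 := (normal_cdf mu1 s1).
Local Notation F2 := (normal_cdf mu2 s2).
Hypothesis hX1 : forall alpha : R, 0 <= alpha <= 1 ->
  has_density (X1 alpha) (mixture_pdf (cut_left p1 p2 alpha)
    (normal_pdf mu1 s1) (normal_pdf mu2 s2)).
Hypothesis hX2 : forall alpha : R, 0 <= alpha <= 1 ->
  has_density (X2 alpha) (mixture_pdf (cut_right p3 p4 alpha)
    (normal_pdf mu1 s1) (normal_pdf mu2 s2)).
Hypothesis hindep : forall alpha : R, 0 <= alpha <= 1 ->
  independent_RV (X1 alpha) (X2 alpha).

Lemma defuzzified_profitE Q :
  defuzzified_profit C M V beta X1 X2 Q =
  ((M - C) * Q - (M - V) * cdf_tail (demand_cdf (coefP1 p1 p2 p3 p4)
     (coefP2 p1 p2 p3 p4) (coefP3 p1 p2 p3 p4) beta F1 F2) Q)%:E.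
Proof.
(* In terms of these five tail integrals, every expected profit below is an explicit linear
   expression, and the final identity is purely algebraic. *)
pose t1 := cdf_tail F1 Q; pose t2 := cdf_tail F2 Q.
pose t11 := cdf_tail (fun x => F1 x ^+ 2) Q.
pose t12 := cdf_tail (fun x => F1 x * F2 x) Q.
pose t22 := cdf_tail (fun x => F2 x ^+ 2) Q.
pose S alpha := cut_left p1 p2 alpha + cut_right p3 p4 alpha.
pose Pi alpha := cut_left p1 p2 alpha * cut_right p3 p4 alpha.
have cdfX1 alpha : 0 <= alpha <= 1 -> forall x, cdf (X1 alpha) x =
    (cut_left p1 p2 alpha * F1 x + (1 - cut_left p1 p2 alpha) * F2 x)%:E.
  move=> a01 x; apply: cdf_mixture; last exact: hX1.
  exact: (cut_left_itv hp1 hp12 hp23 hp34 hp4).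
have cdfX2 alpha : 0 <= alpha <= 1 -> forall x, cdf (X2 alpha) x =
    (cut_right p3 p4 alpha * F1 x + (1 - cut_right p3 p4 alpha) * F2 x)%:E.
  move=> a01 x; apply: cdf_mixture; last exact: hX2.
  exact: (cut_right_itv hp1 hp12 hp23 hp34 hp4).
(* The right-hand side is laid out as [K + L * S alpha + N * Pi alpha], ready for
   [integral_cut_polynomial]. *)
have upperE alpha : 0 <= alpha <= 1 ->
    'E_P[fun w => profit_upper C M V Q (X1 alpha w) (X2 alpha w)]%E =
    ((M - C) * Q - (M - V) * t22 + - (M - V) * (t12 - t22) * S alpha
     + - (M - V) * (t11 - 2 * t12 + t22) * Pi alpha)%:E.
  move=> a01.
  have [Z [Zmax Zcdf]] :=
    cdf_max_independent (cdfX1 _ a01) (cdfX2 _ a01) (hindep a01).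
  under eq_fun do rewrite profit_upperE// -Zmax.
  (* These are the coefficients of the product of the two mixture cdfs: with cut ends [u] and [v],
     they are [uv], [u(1 - v) + v(1 - u)] and [(1 - u)(1 - v)]. *)
  pose F := quadratic_comb 0 0 (Pi alpha) (S alpha - 2 * Pi alpha)
    (1 - S alpha + Pi alpha) F1 F2.
  have ZF x : cdf Z x = (F x)%:E.
    rewrite Zcdf; congr EFin; rewrite /F /quadratic_comb /S /Pi.
    move: (F1 x) (F2 x) (cut_left _ _ _) (cut_right _ _ _) => *.
    by ring.
  rewrite (expectation_profit ZF); last exact: integrable_tail_normal_comb.
  congr EFin; rewrite /F cdf_tail_normal_comb// -/t1 -/t2 -/t11 -/t12 -/t22.
  move: (t1) (t2) (t11) (t12) (t22) (S alpha) (Pi alpha) => *.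
  by ring.
have lowerE alpha : 0 <= alpha <= 1 ->
    'E_P[fun w => profit_lower C M V Q (X1 alpha w) (X2 alpha w)]%E =
    ((M - C) * Q - (M - V) * (2 * t2 - t22)
     + - (M - V) * (t1 - t2 - (t12 - t22)) * S alpha
     + (M - V) * (t11 - 2 * t12 + t22) * Pi alpha)%:E.
  move=> a01.
  have [Z [Zmin Zcdf]] :=
    cdf_min_independent (cdfX1 _ a01) (cdfX2 _ a01) (hindep a01).
  under eq_fun do rewrite profit_lowerE// -Zmin.
  (* The sum of the two mixture cdfs gives the linear part; the quadratic part is the opposite of
     that of the maximum. *)
  pose F := quadratic_comb (S alpha) (2 - S alpha) (- Pi alpha)
    (2 * Pi alpha - S alpha) (S alpha - 1 - Pi alpha) F1 F2.
  have ZF x : cdf Z x = (F x)%:E.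
    rewrite Zcdf; congr EFin; rewrite /F /quadratic_comb /S /Pi.
    move: (F1 x) (F2 x) (cut_left _ _ _) (cut_right _ _ _) => *.
    by ring.
  rewrite (expectation_profit ZF); last exact: integrable_tail_normal_comb.
  congr EFin; rewrite /F cdf_tail_normal_comb// -/t1 -/t2 -/t11 -/t12 -/t22.
  move: (t1) (t2) (t11) (t12) (t22) (S alpha) (Pi alpha) => *.
  by ring.
rewrite /defuzzified_profit.
under eq_integral => alpha.
  rewrite inE/= in_itv/= => a01; rewrite lowerE//; over.
under [X in (_ + _ * X)%E]eq_integral => alpha.
  rewrite inE/= in_itv/= => a01; rewrite upperE//; over.
rewrite !integral_cut_polynomial -!EFinM -EFinD demand_cdfE cdf_tail_normal_comb//.
congr EFin; rewrite -/t1 -/t2 -/t11 -/t12 -/t22 /coefP3 /coefP2 /coefP1.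
move: (t1) (t2) (t11) (t12) (t22) => *.
by field.
Qed.

End defuzzified.

(** * Existence of the fractile and conclusion *)

(** The limits 0 and 1 provide points with values below and above [c], monotonicity of the cdf
    orders these points, and the intermediate value theorem applies between them. *)
Lemma cdf_attains (R : realType) (d : measure_display) (T : measurableType d)
    (P : probability T R) (X : {RV P >-> R}) (F : R -> R) (c : R) :
  (forall x, cdf X x = (F x)%:E) -> continuous F -> 0 < c < 1 ->
  exists x, F x = c.
Proof.
move=> XF cF /andP[c0 c1].
have XE : cdf X = EFin \o F by apply/funext.
have F0 : F x @[x --> -oo] --> (0 : R).
  by have := cvg_cdfNy0 X; rewrite XE => /fine_cvg.
have F1 : F x @[x --> +oo] --> (1 : R).
  by have := cvg_cdfy1 X; rewrite XE => /fine_cvg.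
have [x Fx] := filter_ex (cvgr_lt (0 : R) F0 c c0).
have [y Fy] := filter_ex (cvgr_gt (1 : R) F1 c c1).
have xy : x <= y.
  rewrite leNgt; apply/negP => yx.
  have := cdf_nondecreasing X (ltW yx); rewrite !XF lee_fin => FF.
  by have := lt_trans (le_lt_trans FF Fx) Fy; rewrite ltxx.
have [||z _ Fz] := @IVT R F x y c xy; last by exists z.
- exact: continuous_subspaceT.
- by rewrite ge_min le_max (ltW Fx) (ltW Fy) orbT.
Qed.

Theorem mainTheorem2 (R : realType)
  (C M V : R) (hVC : V < C) (hCM : C < M)
  (mu1 mu2 sigma1 sigma2 : R) (hs1 : 0 < sigma1) (hs2 : 0 < sigma2)
  (p1 p2 p3 p4 : R)
  (hp1 : 0 <= p1) (hp12 : p1 <= p2) (hp23 : p2 <= p3) (hp34 : p3 <= p4)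
  (hp4 : p4 <= 1)
  (beta : R) (hbeta0 : 0 <= beta) (hbeta1 : beta <= 1)
  (d : measure_display) (T : measurableType d) (P : probability T R)
  (X1 X2 : R -> {RV P >-> R})
  (hX1 : forall alpha : R, 0 <= alpha <= 1 ->
     has_density (X1 alpha)
       (mixture_pdf (cut_left p1 p2 alpha)
          (normal_pdf mu1 sigma1) (normal_pdf mu2 sigma2)))
  (hX2 : forall alpha : R, 0 <= alpha <= 1 ->
     has_density (X2 alpha)
       (mixture_pdf (cut_right p3 p4 alpha)
          (normal_pdf mu1 sigma1) (normal_pdf mu2 sigma2)))
  (hindep : forall alpha : R, 0 <= alpha <= 1 ->
     independent_RV (X1 alpha) (X2 alpha))
  (d' : measure_display) (T' : measurableType d') (P' : probability T' R)
  (X : {RV P' >-> R})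
  (hX : forall x : R,
     cdf X x = (demand_cdf (coefP1 p1 p2 p3 p4) (coefP2 p1 p2 p3 p4)
                  (coefP3 p1 p2 p3 p4) beta
                  (normal_cdf mu1 sigma1) (normal_cdf mu2 sigma2) x)%:E) :
  has_density X
    (demand_pdf (coefP1 p1 p2 p3 p4) (coefP2 p1 p2 p3 p4)
       (coefP3 p1 p2 p3 p4) beta
       (normal_pdf mu1 sigma1) (normal_pdf mu2 sigma2)
       (normal_cdf mu1 sigma1) (normal_cdf mu2 sigma2)) /\
  exists Qopt : R,
    (forall Q : R, maximizes (newsvendor_objective C M V X) Q <-> Q = Qopt) /\
    (forall Q : R,
       maximizes (defuzzified_profit C M V beta X1 X2) Q <-> Q = Qopt).
Proof.
set F1 := normal_cdf mu1 sigma1; set F2 := normal_cdf mu2 sigma2.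
set P1 := coefP1 _ _ _ _; set P2 := coefP2 _ _ _ _; set P3 := coefP3 _ _ _ _.
have P1_ge0 : 0 <= P1 by exact: coefP1_ge0.
have P2_ge0 : 0 <= P2 by exact: coefP2_ge0.
have P3_ge0 : 0 <= P3 by exact: coefP3_ge0.
have P_sum : P1 + 2 * P2 + P3 = 2 by exact: coefP_sum.
have beta01 : 0 <= beta <= 1 by rewrite hbeta0.
pose F := demand_cdf P1 P2 P3 beta F1 F2.
have F1_01 x : 0 <= F1 x <= 1 by exact: normal_cdf_itv.
have F2_01 x : 0 <= F2 x <= 1 by exact: normal_cdf_itv.
have dF (x : R) : is_derive x (1 : R) F
    (demand_pdf P1 P2 P3 beta
       (normal_pdf mu1 sigma1) (normal_pdf mu2 sigma2) F1 F2 x).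
  by apply: is_derive_demand_cdf; exact: is_derive_normal_cdf.
have cF : continuous F.
  move=> x; apply: differentiable_continuous.
  by apply/derivable1_diffP; have [] := dF x.
split.
  apply: (cdf_has_density hX) => // [x|x].
    apply: continuous_demand_pdf.
    - exact: continuous_normal_pdf (lt0r_neq0 hs1) x.
    - exact: continuous_normal_pdf (lt0r_neq0 hs2) x.
    - exact: continuous_normal_cdf hs1 x.
    - exact: continuous_normal_cdf hs2 x.
  by apply: demand_pdf_ge0 => //; exact: normal_pdf_ge0.
have F_incr : {homo F : x y / x < y}.
  move=> x y xy.
  have /andP[F1x _] := F1_01 x; have /andP[_ F1y] := F1_01 y.
  have /andP[F2x _] := F2_01 x; have /andP[_ F2y] := F2_01 y.
  have F1xy := normal_cdf_increasing mu1 hs1 xy.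
  have F2xy := normal_cdf_increasing mu2 hs2 xy.
  exact: (demand_cdf_increasing P1_ge0 P2_ge0 P3_ge0 P_sum beta01
    F1xy F2xy F1x F1y F2x F2y).
have iF Q : integrable_tail F Q.
  by rewrite /F demand_cdfE; exact: integrable_tail_normal_comb.
have A0 : 0 < M - V by rewrite subr_gt0 (lt_trans hVC).
(* The critical ratio lies strictly between 0 and 1 because [V < C < M]. *)
have [Q0 FQ0] : exists x, F x = (M - C) / (M - V).
  apply: (cdf_attains hX) => //.
  apply/andP; split; first by rewrite divr_gt0// subr_gt0.
  by rewrite ltr_pdivrMr// mul1r ltrD2l ltrN2.
have AFQ0 : (M - V) * F Q0 = M - C by rewrite FQ0 mulrC divfK// gt_eqF.
have argmax Q := critical_fractile_maximizer A0 F_incr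
  (fun Q Q' => cdf_tail_slope hX (iF Q) (iF Q')) AFQ0 Q.
have newsvendorE Q : newsvendor_objective C M V X Q =
    ((M - C) * Q - (M - V) * cdf_tail F Q)%:E.
  by rewrite /newsvendor_objective (expectation_profit hX)//; exact: iF.
(* Both objectives take the same finite values, so a single statement transfers the real
   maximization to either of them. *)
have maximizesE obj :
    (forall Q, obj Q = ((M - C) * Q - (M - V) * cdf_tail F Q)%:E) ->
    forall Q, maximizes obj Q <-> Q = Q0.
  move=> objE Q; rewrite -argmax; split=> maxQ Q'.
    by have := maxQ Q'; rewrite !objE lee_fin.
  by rewrite !objE lee_fin.
exists Q0; split; apply: maximizesE => // Q.
exact: defuzzified_profitE.
Qed.
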